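(* Let $y_0\in Y$ and let $(\bar\psi(\cdot),\bar\eta(\cdot))\in\mathcal B(Y)\times\mathcal B(Y)$ be an optimal solution of the dual problem at $y_0$ (as defined in the context), assumed to exist. Let $\pi\in\Pi$ be a control plan with state-control trajectory $(y^{\pi,y_0}(\cdot),u^{\pi,y_0}(\cdot))$. Suppose there exists an integer $T_0>0$ such that, for all $t\ge T_0$, $$k(y^{\pi,y_0}(t),u^{\pi,y_0}(t))+\big(\bar\psi(y_0)-\bar\psi(y^{\pi,y_0}(t))\big)+E\big[\bar\eta(f(y^{\pi,y_0}(t),u^{\pi,y_0}(t),s(t)))\,\big|\,y^{\pi,y_0}(t)\big]-\bar\eta(y^{\pi,y_0}(t))=\hat d^*(y_0)\quad\text{a.s.}$$ and $$E[\bar\psi(y^{\pi,y_0}(t))]=\bar\psi(y_0).$$ Then $\pi$ is optimal in the problem $$V(y_0):=\inf_{\pi'\in\Pi}\limsup_{T\to\infty}\frac1TE\Big[\sum_{t=0}^{T-1}k(y^{\pi',y_0}(t),u^{\pi',y_0}(t))\Big]$$ (i.e. $\pi$ attains this infimum), and $V(y_0)=\hat d^*(y_0)$.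
   Context: Model. $Y\subset\mathbb R^n$ is a nonempty compact set, $\hat U$ is a compact metric space, $S$ is a Polish space. The function $f:Y\times\hat U\times S\to\mathbb R^n$ is bounded, continuous in $(y,u)$ on $Y\times\hat U$ and Borel measurable in $s$ on $S$. The $S$-valued random elements $s(0),s(1),\dots$ are independent and identically distributed on a common probability space; $s$ denotes a generic random element with the same distribution, and $E[\varphi(f(y,u,s))]$ is the expectation over $s$ with $(y,u)$ fixed. $U(\cdot)$ is an upper semicontinuous multivalued map from $Y$ to nonempty compact subsets of $\hat U$, and $f(y,u,s)\in Y$ for all $y\in Y$, $u\in U(y)$, $s\in S$. $G:=\{(y,u): y\in Y,\ u\in U(y)\}$ (a compact set). $\Pi$ is the set of control plans $\pi=\{\pi_t(\cdot)\}_{t=0,1,\dots}$, where each $\pi_t:Y\to\hat U$ is Borel measurable with $\pi_t(y)\in U(y)$ for all $y\in Y$. For $\pi\in\Pi$ and $y_0\in Y$, the state-control trajectory $(y^{\pi,y_0}(\cdot),u^{\pi,y_0}(\cdot))$ is defined by $y(0)=y_0$, $u(t)=\pi_t(y(t))$, $y(t+1)=f(y(t),u(t),s(t))$. The function $k:Y\times\hat U\to\mathbb R$ is continuous (hence bounded). Dual problem. $\mathcal B(Y)$ is the space of bounded Borel functions on $Y$. $\hat d^*(y_0)$ is the supremum of $\mu$ over all triplets $(\mu,\psi,\eta)\in\mathbb R\times\mathcal B(Y)\times\mathcal B(Y)$ such that for all $(y,u)\in G$: $k(y,u)+(\psi(y_0)-\psi(y))+E[\eta(f(y,u,s))]-\eta(y)-\mu\ge0$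 and $E[\psi(f(y,u,s))]-\psi(y)\ge0$. A pair $(\bar\psi,\bar\eta)\in\mathcal B(Y)\times\mathcal B(Y)$ is an optimal solution of this dual problem (at $y_0$) if for all $(y,u)\in G$: $k(y,u)+(\bar\psi(y_0)-\bar\psi(y))+E[\bar\eta(f(y,u,s))]-\bar\eta(y)\ge\hat d^*(y_0)$ and $E[\bar\psi(f(y,u,s))]-\bar\psi(y)\ge0$. *)

(* Defs.v *)
From HB Require Import structures.
From mathcomp Require Import all_boot all_order all_algebra.
From mathcomp Require Import all_classical all_reals all_analysis.

Set Implicit Arguments.
Unset Strict Implicit.
Unset Printing Implicit Defensive.

Import Order.TTheory GRing.Theory Num.Theory.
Import numFieldNormedType.Exports.

Local Open Scope classical_set_scope.
Local Open Scope ring_scope.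

(* The library builds measurable spaces on pointed types only; the control
   space must therefore be a metric space with a distinguished point, which
   only excludes the empty space. *)
#[short(type="pointedMetricType")]
HB.structure Definition PointedMetric (K : numDomainType) :=
  { M of Metric K M & isPointed M }.

Notation borel T := (g_sigma_algebraType (@open T)).

Section polish.
Context {R : realType} {T : topologicalType}.

Definition is_metric (d : T -> T -> R) : Prop :=
  [/\ forall x y, 0 <= d x y,
      forall x y, d x y = 0 <-> x = y,
      forall x y, d x y = d y x &
      forall x y z, d x z <= d x y + d y z].

Definition metrizes (d : T -> T -> R) : Prop :=
  forall x (A : set T),
    nbhs x A <-> exists2 e : R, 0 < e & [set y | d x y < e] `<=` A.

Definition complete_dist (d : T -> T -> R) : Prop :=
  forall x : nat -> T,
    (forall e : R, 0 < e -> exists N : nat, forall i j : nat,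
       (N <= i)%N -> (N <= j)%N -> d (x i) (x j) < e) ->
    exists l : T, x @ \oo --> l.

End polish.

Definition polish_space (R : realType) (T : topologicalType) : Prop :=
  (exists2 D : set T, countable D & dense D) /\
  (exists d : T -> T -> R, [/\ is_metric d, metrizes d & complete_dist d]).

Section random_elements.
Context {d d' : measure_display} {Omega : measurableType d}
  {S : measurableType d'} {R : realType} (P : probability Omega R).

Definition mutually_independent (s : nat -> {RV P >-> S}) : Prop :=
  forall (J : seq nat) (A : nat -> set S), uniq J ->
    (forall t, measurable (A t)) ->
    P (\bigcap_(t in [set` J]) (s t @^-1` A t)) =
    (\prod_(t <- J) P (s t @^-1` A t))%E.

Definition iid_with_law (s : nat -> {RV P >-> S}) (law : probability S R)
    : Prop :=
  mutually_independent s /\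
  (forall t (A : set S), measurable A -> distribution P (s t) A = law A).

End random_elements.

(* Z is a version of E[X | g], conditioning on the sigma-algebra
   {g^-1(A) | A measurable} generated by g. *)
Definition is_cond_expectation {d d' : measure_display}
    {Omega : measurableType d} {V : measurableType d'} {R : realType}
    (P : probability Omega R) (X : Omega -> R) (g : Omega -> V)
    (Z : Omega -> R) : Prop :=
  [/\ measurable_fun
        [set: g_sigma_algebraType (preimage_set_system setT g measurable)] Z,
      P.-integrable setT (EFin \o Z) &
      forall A : set V, measurable A ->
        (\int[P]_(w in g @^-1` A) (Z w)%:E
         = \int[P]_(w in g @^-1` A) (X w)%:E)%E].

Section control_system.
Context {R : realType} {n : nat} {U : pointedMetricType R}
  {S : ptopologicalType}.

(* Functions on Y are represented by functions on the whole space, of which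
   only the values on Y matter. *)
Variables (Y : set 'rV[R]_n) (Umap : 'rV[R]_n -> set U)
  (f : 'rV[R]_n -> U -> S -> 'rV[R]_n) (k : 'rV[R]_n -> U -> R).

Definition upper_semicontinuous_on : Prop :=
  forall y, Y y -> forall O : set U, open O -> Umap y `<=` O ->
    \forall y' \near y, Y y' -> Umap y' `<=` O.

Definition graph : set ('rV[R]_n * U) := [set p | Y p.1 /\ Umap p.1 p.2].

Definition bounded_borel (g : 'rV[R]_n -> R) : Prop :=
  measurable_fun (Y : set (borel 'rV[R]_n)) g /\
  (exists M : R, forall y, Y y -> `|g y| <= M).

Definition control_plan (plan : nat -> 'rV[R]_n -> U) : Prop :=
  forall t,
    measurable_fun (Y : set (borel 'rV[R]_n))
      (plan t : borel 'rV[R]_n -> borel U) /\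
    (forall y, Y y -> Umap y (plan t y)).

Section trajectory.
Context {Omega : Type} (s : nat -> Omega -> S)
  (plan : nat -> 'rV[R]_n -> U) (y0 : 'rV[R]_n).

Fixpoint state (t : nat) (w : Omega) : 'rV[R]_n :=
  if t is t'.+1
  then f (state t' w) (plan t' (state t' w)) (s t' w)
  else y0.

Definition control (t : nat) (w : Omega) : U := plan t (state t w).

End trajectory.

Section value.
Local Open Scope ereal_scope.
Context {d : measure_display} {Omega : measurableType d}
  (P : probability Omega R) (s : nat -> Omega -> S) (y0 : 'rV[R]_n).

Definition average_cost (plan : nat -> 'rV[R]_n -> U) : \bar R :=
  limn_esup (fun T : nat => (T%:R^-1)%:E *
    'E_P[fun w => (\sum_(0 <= t < T)
           k (state s plan y0 t w) (control s plan y0 t w))%R]).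

Definition optimal_value : \bar R :=
  ereal_inf [set average_cost plan | plan in control_plan].

End value.

Section dual.
Local Open Scope ereal_scope.
Context (law : probability (borel S) R) (y0 : 'rV[R]_n).

(* E[phi(f(y,u,s))] for s distributed according to law. *)
Definition expect_next (phi : 'rV[R]_n -> R) (y : 'rV[R]_n) (u : U) : \bar R :=
  'E_law[fun x => phi (f y u x)].

Definition dual_feasible (mu : R) (psi eta : 'rV[R]_n -> R) : Prop :=
  [/\ bounded_borel psi, bounded_borel eta &
      forall y u, graph (y, u) ->
        0 <= (k y u + (psi y0 - psi y))%R%:E + expect_next eta y u
             - (eta y)%:E - mu%:E /\
        0 <= expect_next psi y u - (psi y)%:E].

Definition dual_value : \bar R :=
  ereal_sup [set mu%:E | mu in
    [set mu | exists psi eta, dual_feasible mu psi eta]].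

Definition dual_optimal (psi eta : 'rV[R]_n -> R) : Prop :=
  [/\ bounded_borel psi, bounded_borel eta &
      forall y u, graph (y, u) ->
        dual_value <= (k y u + (psi y0 - psi y))%R%:E + expect_next eta y u
                      - (eta y)%:E /\
        0 <= expect_next psi y u - (psi y)%:E].

End dual.

End control_system.

(* Main.v *)
Require Import Defs.
From HB Require Import structures.
From mathcomp Require Import all_boot all_order all_algebra.
From mathcomp Require Import all_classical all_reals all_analysis.
From mathcomp Require Import measurable_realfun lra.

Set Implicit Arguments.
Unset Strict Implicit.
Unset Printing Implicit Defensive.

Import Order.TTheory GRing.Theory Num.Theory.
Import numFieldNormedType.Exports.

Local Open Scope classical_set_scope.
Local Open Scope ring_scope.

(** Summing the first dual inequality along a trajectory telescopes [eta], and the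
second one makes the expectation of [psi] nondecreasing in time, so every control
plan has average cost at least the dual value; under the complementary slackness
hypotheses all these inequalities are equalities from time [T0] on. Both dual
inequalities are about a fixed pair (y,u), so taking expectations along the
trajectory requires that the noise s(t) be independent of the sigma-algebra of
s(0), ..., s(t-1), for which the state at time t is measurable, and that f be
jointly measurable, which holds because it is a Caratheodory function. *)

(** * Measurability of pointwise limits and of Caratheodory functions *)

(* Measurability into a topological space is phrased through preimages of open
   sets because the product of two pointed spaces and the row vectors are not
   canonically pointed pseudometric spaces, as [borel] would require. *)
Lemma open_preimage_measurable_fun d (T : measurableType d)
    (Z : ptopologicalType) (g : T -> Z) :
  (forall B : set Z, open B -> measurable (g @^-1` B)) ->
  measurable_fun [set: T] (g : T -> borel Z).
Proof.
move=> mg; apply: (@measurability _ _ T (borel Z) _ g (@open Z)) => // _ [B oB <-].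
by rewrite setTI; exact: mg.
Qed.

(** The limit [g w] lies in the closed complement [C] of [B] iff, for every [j], the points [h m w]
    eventually lie in the [1/(j+1)]-neighbourhood of [C], a condition built from countably many set
    operations. Interiors of balls are used because balls of a pseudometric structure need not be
    open. *)
Lemma open_preimage_measurable_cvg d (T : measurableType d) (R : realType)
    (Z : pseudoMetricType R) (h : nat -> T -> Z) (g : T -> Z) :
  (forall m (B : set Z), open B -> measurable (h m @^-1` B)) ->
  (forall w, h ^~ w @ \oo --> g w) ->
  forall B : set Z, open B -> measurable (g @^-1` B).
Proof.
move=> mh hg B oB.
pose C := ~` B; have cC : closed C by exact: open_closedC.
pose near_C j := \bigcup_(c in C) (ball c (j.+1%:R^-1 : R))^°.
suff -> : g @^-1` B = ~` (\bigcap_j \bigcup_N \bigcap_(m in [set m | (N <= m)%N])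
    (h m @^-1` near_C j)).
  apply: measurableC; apply: bigcapT_measurable => j.
  apply: bigcupT_measurable => N; apply: bigcap_measurable => [|m _].
    by exists N => /=.
  by apply: mh; apply: bigcup_open => c _; exact: open_interior.
rewrite -[B]setCK -/C preimage_setC; congr (~` _); apply/seteqP; split => w.
  move=> Cgw j _; have : nbhs (g w) (ball (g w) (j.+1%:R^-1 : R))^°.
    by apply: nbhs_interior; exact: nbhsx_ballx.
  by move=> /hg[N _ hN]; exists N => // m Nm; exists (g w) => //; exact: hN.
move=> wC; apply: cC => V /nbhs_ballP[e /= e0 eV].
have e20 : 0 < e / 2 by rewrite divr_gt0.
have [j je] : exists j, (j.+1%:R^-1 : R) < e / 2.
  by have [k] := ltr_add_invr e20; rewrite add0r => ke; exists k.
have [N _ hN] := wC j I.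
have [N' _ hN'] := hg w _ (nbhsx_ballx (g w) (e / 2) e20).
have [|c Cc hc] := hN (maxn N N'); first by rewrite /= leq_maxl.
exists c; split=> //; apply: eV.
apply: (@ball_splitr _ _ (h (maxn N N') w)).
  by apply: ball_sym; apply: hN'; rewrite /= leq_maxr.
apply: ball_sym; apply: le_ball (ltW je) _ _.
exact: interior_subset hc.
Qed.

Lemma compact_totally_bounded (R : realType) (X : pseudoMetricType R)
    (K : set X) (e : R) : compact K -> 0 < e ->
  exists2 s : seq X, {in s, forall p, K p} &
    forall x, K x -> exists2 p, p \in s & ball p e x.
Proof.
move=> cK e0; have [->|/set0P[x0 _]] := eqVneq K set0; first by exists [::].
(* A point of [K] serves as the distinguished point, so that compactness can be used in its
   open-cover form. *)
pose X' := HB.pack_for ptopologicalType (X : Type)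
  (Topological.on (X : Type)) (isPointed.Build (X : Type) x0).
have : @compact X' K by exact: cK.
rewrite compact_cover => /(_ X K (fun p => (ball p e)^°)) [||s sK Ks].
- by move=> p _; exact: open_interior.
- by move=> x Kx; exists x => //; exact: nbhsx_ballx.
exists (finmap.enum_fset s) => [p /sK|x /Ks[p /= ps pex]]; first by rewrite inE.
by exists p => //; exact: interior_subset pex.
Qed.

Lemma continuous_within_ball (R : realType) (X Z : pseudoMetricType R)
    (K : set X) (F : X -> Z) (x : X) (B : set Z) :
  {within K, continuous F} -> K x -> nbhs (F x) B ->
  exists2 e : R, 0 < e & forall y, K y -> ball x e y -> B (F y).
Proof.
move=> cF Kx FxB; have : within K (nbhs x) (F @^-1` B).
  by move: (cF x B FxB); rewrite nbhs_simpl/= (nbhs_subspace_in Kx).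
move=> /nbhs_ballP[e /= e0 eB]; exists e => // y Ky xy; exact: eB.
Qed.

(* A Caratheodory function composed with measurable maps is the pointwise limit
   of the functions obtained by rounding the continuous argument to a finite net. *)
Lemma caratheodory_comp_measurable d (T : measurableType d) (R : realType)
    (X Z : pseudoMetricType R) (K : set X) (F : X -> T -> Z) (g : T -> X) :
  compact K -> (forall w, K (g w)) ->
  (forall p (e : R), 0 < e -> measurable [set w | ball p e (g w)]) ->
  (forall p, K p -> forall B : set Z, open B -> measurable (F p @^-1` B)) ->
  (forall w, {within K, continuous F^~ w}) ->
  forall B : set Z, open B -> measurable ((fun w => F (g w) w) @^-1` B).
Proof.
move=> cK Kg mg mF cF.
have [s sK Ks] : exists2 s : nat -> seq X, forall m, {in s m, forall p, K p} &
    forall m x, K x -> exists2 p, p \in s m & ball p m.+1%:R^-1 x.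
  have /choice[s hs] : forall m, exists s : seq X, {in s, forall p, K p} /\
      forall x, K x -> exists2 p, p \in s & ball p m.+1%:R^-1 x.
    move=> m; have [|s] := compact_totally_bounded (e := m.+1%:R^-1 : R) cK.
      by rewrite invr_gt0.
    by exists s.
  by exists s => m; have [] := hs m.
(* [round] evaluates [F] at the first point of the list [r] within [e] of [g w]; the default [z] is
   never reached when [r] is an [e]-net of [K]. *)
pose round e z r w := foldr (fun p a => if `[< ball p e (g w) >] then F p w else a) z r.
have mround e z r : {in r, forall p, K p} -> 0 < e ->
    forall B : set Z, open B -> measurable (round e z r @^-1` B).
  move=> + e0; elim: r => [|p r IH] rK B oB.
    by rewrite (preimage_cst z B); case: ifP.
  have -> : round e z (p :: r) @^-1` B
    = ([set w | ball p e (g w)] `&` F p @^-1` B)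
      `|` (~` [set w | ball p e (g w)] `&` round e z r @^-1` B).
    apply/seteqP; split => w /=; case: asboolP => hp; tauto.
  apply: measurableU; apply: measurableI.
  - exact: mg.
  - by apply: mF => //; apply: rK; rewrite mem_head.
  - by apply: measurableC; exact: mg.
  - by apply: IH => // q qr; apply: rK; rewrite inE qr orbT.
have roundP e z r w : (exists2 p, p \in r & ball p e (g w)) ->
    exists p, [/\ p \in r, ball p e (g w) & round e z r w = F p w].
  elim: r => [[]//|p r IH] /= [q]; rewrite inE.
  case: asboolP => [pw _ _|npw /predU1P[-> //|qr] qw].
    by exists p; split=> //; rewrite mem_head.
  have [|q' [q'r q'w ->]] := IH; first by exists q.
  by exists q'; split=> //; rewrite inE q'r orbT.
(* The default value of [round] is taken from a point of [T]; if [T] is empty, every preimage is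
   empty. *)
have [w0|noT] := pselect (exists w0 : T, True); last first.
  move=> B _; rewrite (_ : _ @^-1` _ = set0) ?measurable0//.
  by apply/seteqP; split => // w; case: noT; exists w.
have [{}w0 _] := w0.
apply: (@open_preimage_measurable_cvg _ _ _ _
  (fun m => round m.+1%:R^-1 (F (g w0) w0) (s m))) => [m|w].
  exact: mround.
(* Once [1/(m+1) < e], the selected net point is in [K] and within [e] of [g w], so continuity along
   [K] puts the rounded value in [B]. *)
move=> B /= FB; have [e e0 eB] := continuous_within_ball (cF w) (Kg w) FB.
have [N _ hN] := near_infty_natSinv_lt (PosNum e0).
exists N => // m Nm /=.
have [|p [ps pw ->]] := @roundP m.+1%:R^-1 (F (g w0) w0) (s m) w.
  exact: Ks.
apply: eB; first exact: sK ps.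
by apply: ball_sym; apply: le_ball pw; exact/ltW/hN.
Qed.

Lemma open_ball_metric (R : realType) (M : metricType R) (x : M) (e : R) :
  open (ball x e).
Proof.
rewrite openE => y xy; apply/nbhs_ballP.
move: xy; rewrite ballEmdist /= => xy; exists (e - mdist x y); rewrite /= ?subr_gt0//.
move=> z; rewrite !ballEmdist/= => yz.
by apply: le_lt_trans (metric_triangle _ y _) _; rewrite -ltrBrDl.
Qed.

Lemma measurable_fun_borelR d (T : measurableType d) (R : realType) (g : T -> R) :
  (forall B : set R, open B -> measurable (g @^-1` B)) -> measurable_fun setT g.
Proof.
move=> mg; apply: (measurability _ (RGenOpens.measurableE R)) => // _ [_ [x [y ->]] <-].
by rewrite setTI; apply: mg; exact: interval_open.
Qed.

(** * Measurability of states, controls and costs *)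

Section trajectories.
Context {R : realType} {n : nat} {U : pointedMetricType R} {S : ptopologicalType}.
Context (Y : set 'rV[R]_n) (Umap : 'rV[R]_n -> set U)
  (f : 'rV[R]_n -> U -> S -> 'rV[R]_n) (k : 'rV[R]_n -> U -> R).
Hypotheses (Yc : compact Y) (Uc : compact [set: U]).
Hypothesis fc : forall x : S,
  {within Y `*` [set: U], continuous (fun p : 'rV[R]_n * U => f p.1 p.2 x)}.
Hypothesis fm : forall y u, Y y ->
  measurable_fun [set: borel S] (f y u : borel S -> borel 'rV[R]_n).
Hypothesis fY : forall y u x, Y y -> Umap y u -> Y (f y u x).
Hypothesis kc :
  {within Y `*` [set: U], continuous (fun p : 'rV[R]_n * U => k p.1 p.2)}.

Lemma measurable_compact_states : measurable (Y : set (borel 'rV[R]_n)).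
Proof.
rewrite -[Y]setCK; apply: (@measurableC _ (borel 'rV[R]_n)).
apply: sub_sigma_algebra; apply: closed_openC; apply: compact_closed Yc.
exact: norm_hausdorff.
Qed.

(** Balls of the product are products of balls, so measurability of [a] and [b] separately suffices
    to apply the Caratheodory lemma on the compact set [Y * U]. *)
Lemma caratheodory_state_control_measurable d (T : measurableType d)
    (Z : pseudoMetricType R) (F : 'rV[R]_n -> U -> T -> Z)
    (a : T -> 'rV[R]_n) (b : T -> U) :
  measurable_fun [set: T] (a : T -> borel 'rV[R]_n) ->
  measurable_fun [set: T] (b : T -> borel U) ->
  (forall w, Y (a w)) ->
  (forall y u, Y y -> forall B : set Z, open B -> measurable (F y u @^-1` B)) ->
  (forall w,
    {within Y `*` [set: U], continuous (fun p : 'rV[R]_n * U => F p.1 p.2 w)}) ->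
  forall B : set Z, open B -> measurable ((fun w => F (a w) (b w) w) @^-1` B).
Proof.
move=> ma mb aY mF cF.
apply: (@caratheodory_comp_measurable _ _ _ _ _ (Y `*` setT)
  (fun p : 'rV[R]_n * U => F p.1 p.2) (fun w => (a w, b w))) => //.
- exact: compact_setX.
- by move=> w; split=> //; exact: aY.
- move=> p e _.
  rewrite (_ : mkset _ = a @^-1` ball p.1 e `&` b @^-1` ball p.2 e)//.
  apply: measurableI; rewrite -[X in measurable X]setTI; [apply: ma|apply: mb] => //.
    by apply: sub_sigma_algebra; exact: ball_open.
  by apply: sub_sigma_algebra; exact: open_ball_metric.
- by move=> [y u] [Yy _] B oB; exact: mF.
Qed.

Lemma next_state_measurable d (T : measurableType d)
    (a : T -> 'rV[R]_n) (b : T -> U) (c : T -> S) :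
  measurable_fun [set: T] (a : T -> borel 'rV[R]_n) ->
  measurable_fun [set: T] (b : T -> borel U) ->
  measurable_fun [set: T] (c : T -> borel S) ->
  (forall w, Y (a w)) ->
  measurable_fun [set: T] ((fun w => f (a w) (b w) (c w)) : T -> borel 'rV[R]_n).
Proof.
move=> ma mb mc aY; apply: open_preimage_measurable_fun.
apply: (@caratheodory_state_control_measurable _ _ _ (fun y u w => f y u (c w))) => //.
move=> y u Yy B oB; rewrite -[X in measurable X]setTI.
apply: (measurableT_comp (fm u Yy) mc) => //.
exact: sub_sigma_algebra.
Qed.

Lemma cost_measurable d (T : measurableType d) (a : T -> 'rV[R]_n) (b : T -> U) :
  measurable_fun [set: T] (a : T -> borel 'rV[R]_n) ->
  measurable_fun [set: T] (b : T -> borel U) ->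
  (forall w, Y (a w)) ->
  measurable_fun [set: T] (fun w => k (a w) (b w)).
Proof.
move=> ma mb aY; apply: measurable_fun_borelR.
apply: (@caratheodory_state_control_measurable _ _ _ (fun y u _ => k y u)) => //.
by move=> y u Yy B oB; rewrite (preimage_cst (k y u) B); case: ifP.
Qed.

Lemma cost_bounded : exists M : R, forall y u, Y y -> `|k y u| <= M.
Proof.
have [M [_ kM]] := compact_bounded (continuous_compact kc (compact_setX Yc Uc)).
(* [compact_bounded] gives a bound by every number strictly above [M], hence [M + 1]. *)
exists (M + 1) => y u Yy; apply: (kM (M + 1)); first by rewrite ltrDl.
by exists (y, u).
Qed.

Lemma bounded_borel_state_measurable d (T : measurableType d) (g : 'rV[R]_n -> R)
    (a : T -> 'rV[R]_n) :
  bounded_borel Y g -> measurable_fun [set: T] (a : T -> borel 'rV[R]_n) ->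
  (forall w, Y (a w)) -> measurable_fun [set: T] (g \o a).
Proof.
move=> [mg _] ma aY.
apply: (measurable_comp measurable_compact_states) mg ma => _ [w _ <-]; exact: aY.
Qed.

Section plan.
Context (plan : nat -> 'rV[R]_n -> U) (planP : control_plan Y Umap plan).
Context (y0 : 'rV[R]_n) (Yy0 : Y y0).

Lemma state_in (Omega : Type) (s : nat -> Omega -> S) t w :
  Y (state f s plan y0 t w).
Proof. by elim: t => //= t IH; apply: fY => //; apply: (planP t).2. Qed.

Lemma control_in (Omega : Type) (s : nat -> Omega -> S) t w :
  Umap (state f s plan y0 t w) (control f s plan y0 t w).
Proof. by apply: (planP t).2; exact: state_in. Qed.

Lemma control_measurable d (T : measurableType d) (s : nat -> T -> S) t :
  measurable_fun [set: T] (state f s plan y0 t : T -> borel 'rV[R]_n) ->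
  measurable_fun [set: T] (control f s plan y0 t : T -> borel U).
Proof.
apply: (measurable_comp measurable_compact_states) => //; last exact: (planP t).1.
by move=> _ [w _ <-]; exact: state_in.
Qed.

(** Only the noises before [t] are assumed measurable and [T] is arbitrary, so that the lemma also
    applies to the sigma-algebra generated by those noises. *)
Lemma state_measurable d (T : measurableType d) (s : nat -> T -> S) t :
  (forall i, (i < t)%N -> measurable_fun [set: T] (s i : T -> borel S)) ->
  measurable_fun [set: T] (state f s plan y0 t : T -> borel 'rV[R]_n).
Proof.
elim: t => [|t IH] ms; first exact: measurable_cst.
have mt := IH (fun i it => ms i (ltnW it)).
apply: next_state_measurable => //.
- exact: control_measurable.
- exact: ms.
- exact: state_in.
Qed.

End plan.
End trajectories.

(** * Integrability, and independence of the noise from the past *)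

Lemma probability_bounded_integrable d (T : measurableType d) (R : realType)
    (P : probability T R) (h : T -> R) :
  measurable_fun [set: T] h -> (exists M, forall x, `|h x| <= M) ->
  P.-integrable [set: T] (EFin \o h).
Proof.
move=> mh [M hM]; apply: measurable_bounded_integrable => //.
  exact: le_lt_trans (probability_le1 P measurableT) (ltry 1).
exists M; split; first exact: num_real.
by move=> r Mr x _; apply: le_trans (hM x) (ltW Mr).
Qed.

Section independence.
Context {d d' : measure_display} {Omega : measurableType d} {S : measurableType d'}
  {R : realType} (P : probability Omega R).
Context (s : nat -> {RV P >-> S}) (law : probability S R).
Hypothesis siid : iid_with_law s law.

(** A generating family of the sigma-algebra of [s 0, ..., s (t-1)]. Finite intersections of
    preimages are taken, rather than single preimages, to obtain a pi-system on which measures can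
    be compared. *)
Definition past_cylinders (t : nat) : set (set Omega) :=
  [set C | exists2 A : nat -> set S, forall i, measurable (A i) &
    C = \bigcap_(i in [set i | (i < t)%N]) s i @^-1` A i].

Local Notation past t := (g_sigma_algebraType (past_cylinders t)).

Lemma past_cylinders_setI t : setI_closed (past_cylinders t).
Proof.
move=> _ _ [A mA ->] [B mB ->]; exists (fun i => A i `&` B i).
  by move=> i; exact: measurableI.
by rewrite -bigcapI; apply: eq_bigcapr => i _; rewrite preimage_setI.
Qed.

Lemma past_cylinders_setT t : past_cylinders t setT.
Proof.
by exists (fun=> setT) => //; apply/seteqP; split.
Qed.

Lemma past_cylinders_measurable t C : past_cylinders t C -> measurable C.
Proof.
move=> [A mA ->]; rewrite bigcap_mkcond; apply: bigcapT_measurable => i.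
by case: ifP => // _; rewrite -[X in measurable X]setTI; exact: measurable_funP.
Qed.

Lemma measurable_to_past t : measurable_fun [set: Omega] (id : Omega -> past t).
Proof.
apply: (@measurability _ _ _ (past t) _ _ (past_cylinders t)) => // _ [C pC <-].
by rewrite setTI; exact: past_cylinders_measurable pC.
Qed.

Lemma measurable_past t i : (i < t)%N ->
  measurable_fun [set: past t] (s i : past t -> S).
Proof.
move=> it _ B mB; rewrite setTI; apply: sub_sigma_algebra.
exists (fun j => if j == i then B else setT) => [j|]; first by case: ifP.
apply/seteqP; split => [w Bw j /= _|w /(_ i it)]; last by rewrite eqxx.
by case: eqP => [->|].
Qed.

(** The identity into the coarser sigma-algebra stands for the vector of past noises; its
    distribution is [P] restricted to the past. *)
Definition past_RV t : {RV P >-> past t} :=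
  HB.pack_for {mfun Omega >-> past t} (id : Omega -> past t)
    (isMeasurableFun.Build _ _ _ _ _ (@measurable_to_past t)).

Lemma measurable_past_pair t :
  measurable_fun [set: Omega] (fun w => (w, s t w) : (past t * S)%type).
Proof. by apply/measurable_fun_pair => //; exact: measurable_to_past. Qed.

Definition past_pair_RV t : {RV P >-> (past t * S)%type} :=
  HB.pack_for {mfun Omega >-> (past t * S)%type}
    (fun w => (w, s t w) : (past t * S)%type)
    (isMeasurableFun.Build _ _ _ _ _ (@measurable_past_pair t)).

Lemma past_independent_cylinder t C B : past_cylinders t C -> measurable B ->
  P (C `&` s t @^-1` B) = (law B * P C)%E.
Proof.
move=> [A mA ->] mB; have [ind slaw] := siid.
rewrite -(slaw t)// {1}/distribution/= /pushforward.
(* The condition on [s t] becomes the coordinate [t] of a cylinder of length [t.+1], to which mutual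
   independence applies; its last factor then splits off. *)
pose A' i := if i == t then B else A i.
have mA' i : measurable (A' i) by rewrite /A'; case: ifP.
have capE (D : nat -> set Omega) r :
  \bigcap_(i in [set i | (i < r)%N]) D i = \bigcap_(i in [set` iota 0 r]) D i.
  by congr bigcap; apply/seteqP; split=> i /=; rewrite mem_iota.
have A'E i : (i < t)%N -> A' i = A i by move=> it; rewrite /A' ltn_eqF.
have -> : \bigcap_(i in [set i | (i < t)%N]) s i @^-1` A i `&` s t @^-1` B =
    \bigcap_(i in [set` iota 0 t.+1]) s i @^-1` A' i.
  rewrite -capE; apply/seteqP; split => [w [Aw Bw] i /=|w Aw].
    rewrite ltnS leq_eqVlt => /predU1P[->|it]; first by rewrite /A' eqxx.
    by rewrite A'E//; exact: Aw.
  split; first by move=> i /= it; rewrite -A'E//; apply: Aw; rewrite /= ltnS ltnW.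
  by have := Aw t (ltnSn t); rewrite /A' eqxx.
rewrite capE !ind ?iota_uniq//.
rewrite -addn1 iotaD big_cat/= big_seq1 add0n /A' eqxx muleC; congr (_ * _)%E.
by apply: eq_big_seq => i; rewrite mem_iota/= add0n => it; rewrite ltn_eqF.
Qed.

(** For fixed [B], both sides are finite measures in [C]. They agree on the pi-system of cylinders,
    which contains the whole space, hence everywhere on the past. *)
Lemma past_independent t C B : measurable (C : set (past t)) -> measurable B ->
  P (C `&` s t @^-1` B) = (law B * P C)%E.
Proof.
move=> mC mB.
have msB : measurable (s t @^-1` B).
  by rewrite -[X in measurable X]setTI; exact: measurable_funP.
have lB0 : 0 <= fine (law B) by rewrite fine_ge0.
have mid : measurable_fun [set: Omega] (past_RV t) by exact: measurable_to_past.
(* [m1] is a function of a measurability proof: the canonical measure structure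
   on pushforwards takes one as an argument. *)
pose m1 : measure (past t) R :=
  pushforward (mrestr P msB) (past_RV t).
pose m2 : measure (past t) R := mscale (NngNum lB0) (distribution P (past_RV t)).
have lawBE : (NngNum lB0)%:num%:E = law B by rewrite /= fineK ?fin_num_measure.
have m2E A : m2 A = (law B * P A)%E by rewrite /m2/= /mscale lawBE.
rewrite -m2E; apply: (@measure_unique _ _ (past t) (past_cylinders t) (fun=> setT)
  erefl _ _ _ (m1 mid)) => //.
- exact: past_cylinders_setI.
- by move=> _; exact: past_cylinders_setT.
- by rewrite bigcup_const//; exists 0%N.
- by move=> A cA; rewrite m2E; exact: past_independent_cylinder.
- move=> _; rewrite /m1/= /pushforward /mrestr preimage_setT setTI.
  exact: le_lt_trans (probability_le1 P msB) (ltry 1).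
Qed.

Lemma distribution_past_pair t (X : set (past t * S)%type) : measurable X ->
  (distribution P (past_RV t) \x law)%E X = distribution P (past_pair_RV t) X.
Proof.
apply: product_measure_unique => A B mA mB.
by rewrite muleC; exact: past_independent.
Qed.

(** Freezing lemma: by independence the joint law of the past and [s t] is a product, so Fubini
    integrates the noise first with the past held fixed. *)
Lemma integral_past t (h : (past t * S)%type -> R) :
  measurable_fun setT h -> (exists M, forall p, `|h p| <= M) ->
  (\int[P]_w (h (w, s t w))%:E = \int[P]_w \int[law]_x (h (w, x))%:E)%E.
Proof.
move=> mh hM.
transitivity (\int[distribution P (past_pair_RV t)]_p (h p)%:E)%E.
  rewrite integral_distribution//; first exact/measurable_EFinP.
  apply: probability_bounded_integrable; last by case: hM => M hM; exists M.
  exact: measurableT_comp.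
transitivity (\int[distribution P (past_RV t) \x law]_p (h p)%:E)%E.
  by apply: eq_measure_integral => A mA _; exact/esym/distribution_past_pair.
have ih : (distribution P (past_RV t) \x law)%E.-integrable setT (EFin \o h).
  exact: probability_bounded_integrable.
rewrite -integral12_prod_meas1//.
rewrite integral_distribution//; first exact: (measurable_fubini_F ih).
(* The change of variables back to [P] requires the inner integral to be integrable there; this is
   carried over from the distribution of the past. *)
have mF := measurable_fubini_F ih.
have /integrableP[_ iF] := integrable_fubini_F ih.
apply/integrableP; split; first exact: (measurableT_comp mF (@measurable_to_past t)).
rewrite -(ge0_integral_distribution (past_RV t)
  (f := fun w => `|fubini_F law (EFin \o h) w|%E))//.
exact: measurableT_comp.
Qed.

End independence.

(** * Upper limits of averages, telescoping sums and bounded Borel functions *)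

Section limn_esup_extra.
Context {R : realType}.

(** The upper limit is an infimum of suprema over the sets of the filter, and each such set may be
    cut down to the indices where [u T <= v T]. *)
Lemma le_limn_esup_near (u v : nat -> \bar R) :
  (\forall T \near \oo, (u T <= v T)%E) -> (limn_esup u <= limn_esup v)%E.
Proof.
move=> uv; apply: le_ereal_inf_tmp => _ [A Aoo <-].
apply: (@le_trans _ _ (ereal_sup (u @` (A `&` [set T | (u T <= v T)%E])))).
  apply: ereal_inf_lbound; exists (A `&` [set T | (u T <= v T)%E]) => //.
  exact: filterI.
apply: ge_ereal_sup => _ [T [AT uvT] <-]; apply: le_trans uvT _.
by apply: ereal_sup_ubound; exists T.
Qed.

Lemma limn_esup_affine (m C : R) :
  limn_esup (fun T => (T%:R^-1 * (T%:R * m + C))%:E) = m%:E.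
Proof.
have h : (T%:R^-1 * (T%:R * m + C))%:E @[T --> \oo] --> m%:E.
  apply: cvg_EFin; first by near=> T.
  have Vn0 : (T%:R^-1 : R) @[T --> \oo] --> 0.
    apply/gtr0_cvgV0; last exact: cvgr_idn.
    by near=> T; rewrite ltr0n; near: T; exact: nbhs_infty_gt.
  have : m + T%:R^-1 * C @[T --> \oo] --> m + 0 * C.
    by apply: cvgD; [exact: cvg_cst|apply: cvgM => //; exact: cvg_cst].
  (* The two expressions agree for [T > 0]; at [T = 0], where the inverse is [0], they may
     differ. *)
  rewrite mul0r addr0; apply: cvg_trans; apply: near_eq_cvg; near=> T.
  rewrite /= mulrDr mulrA mulVf ?mul1r// pnatr_eq0 -lt0n.
  by near: T; exact: nbhs_infty_gt.
by rewrite is_cvg_limn_esupE; [exact/cvg_lim|apply/cvg_ex; exists m%:E].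
Unshelve. all: by end_near. Qed.

Lemma limn_esup_mean_ge (m C : R) (a : nat -> R) (N : nat) :
  (forall T, (N <= T)%N -> T%:R * m + C <= a T) ->
  (m%:E <= limn_esup (fun T => (T%:R^-1 * a T)%:E))%E.
Proof.
move=> ma; rewrite -(limn_esup_affine m C); apply: le_limn_esup_near.
exists N => // T NT; rewrite /= lee_fin ler_wpM2l ?invr_ge0//; exact: ma.
Qed.

Lemma limn_esup_mean_le (m C : R) (a : nat -> R) (N : nat) :
  (forall T, (N <= T)%N -> a T <= T%:R * m + C) ->
  (limn_esup (fun T => (T%:R^-1 * a T)%:E) <= m%:E)%E.
Proof.
move=> ma; rewrite -[leRHS](limn_esup_affine m C); apply: le_limn_esup_near.
exists N => // T NT; rewrite /= lee_fin ler_wpM2l ?invr_ge0//; exact: ma.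
Qed.

End limn_esup_extra.

Lemma sumr_add_telescope (R : realType) (m : R) (b : nat -> R) (T0 T : nat) :
  (T0 <= T)%N ->
  \sum_(T0 <= t < T) (m + b t - b t.+1) = (T - T0)%:R * m + b T0 - b T.
Proof.
move=> T0T; under eq_bigr do rewrite -addrA -opprB.
rewrite big_split/= sumr_const_nat sumrN telescope_sumr// mulr_natl.
by rewrite opprB addrA.
Qed.

Lemma Rintegral_probability_cst d (T : measurableType d) (R : realType)
    (P : probability T R) (r : R) : \int[P]_w (cst r w) = r.
Proof.
by rewrite /Rintegral; have := expectation_cst P r; rewrite unlock => ->.
Qed.

Lemma bounded_borel_cst (R : realType) (n : nat) (Y : set 'rV[R]_n) (r : R) :
  bounded_borel Y (fun=> r).
Proof. by split; [exact: measurable_cst|exists `|r|]. Qed.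

Lemma bounded_borelB (R : realType) (n : nat) (Y : set 'rV[R]_n)
    (g h : 'rV[R]_n -> R) :
  bounded_borel Y g -> bounded_borel Y h -> bounded_borel Y (fun y => g y - h y).
Proof.
move=> [mg [M gM]] [mh [N hN]]; split.
  exact: (measurable_funB (T := borel 'rV[R]_n)).
by exists (M + N) => y Yy'; apply: le_trans (ler_normB _ _) (lerD _ _); auto.
Qed.

(** * Expectations along a trajectory *)

Section trajectory_costs.
Context {R : realType} {n : nat} {U : pointedMetricType R} {S : ptopologicalType}.
Context (Y : set 'rV[R]_n) (Umap : 'rV[R]_n -> set U)
  (f : 'rV[R]_n -> U -> S -> 'rV[R]_n) (k : 'rV[R]_n -> U -> R).
Hypotheses (Yc : compact Y) (Uc : compact [set: U]).
Hypothesis fc : forall x : S,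
  {within Y `*` [set: U], continuous (fun p : 'rV[R]_n * U => f p.1 p.2 x)}.
Hypothesis fm : forall y u, Y y ->
  measurable_fun [set: borel S] (f y u : borel S -> borel 'rV[R]_n).
Hypothesis fY : forall y u x, Y y -> Umap y u -> Y (f y u x).
Hypothesis kc :
  {within Y `*` [set: U], continuous (fun p : 'rV[R]_n * U => k p.1 p.2)}.
Context {d : measure_display} {Omega : measurableType d} (P : probability Omega R).
Context (s : nat -> {RV P >-> borel S}) (law : probability (borel S) R).
Hypothesis siid : iid_with_law s law.
Context (plan : nat -> 'rV[R]_n -> U) (planP : control_plan Y Umap plan).
Context (y0 : 'rV[R]_n) (Yy0 : Y y0).

Local Notation y_ := (state f s plan y0).
Local Notation u_ := (control f s plan y0).

Let Yy t w : Y (y_ t w). Proof. exact: (state_in fY planP Yy0). Qed.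

Let my d' (T : measurableType d') (s' : nat -> T -> S) t :
  (forall i, (i < t)%N -> measurable_fun [set: T] (s' i : T -> borel S)) ->
  measurable_fun [set: T] (state f s' plan y0 t : T -> borel 'rV[R]_n).
Proof. exact: (state_measurable Yc Uc fc fm fY planP Yy0). Qed.

Lemma integrable_state (g : 'rV[R]_n -> R) t : bounded_borel Y g ->
  P.-integrable [set: Omega] (EFin \o (fun w => g (y_ t w))).
Proof.
move=> gb; apply: probability_bounded_integrable.
  by apply: (bounded_borel_state_measurable Yc gb) => //; exact: my.
by have [_ [M gM]] := gb; exists M => w; exact: gM.
Qed.

Lemma integrable_cost t :
  P.-integrable [set: Omega] (EFin \o (fun w => k (y_ t w) (u_ t w))).
Proof.
apply: probability_bounded_integrable.
  apply: (cost_measurable Yc Uc kc) => //; first exact: my.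
  by apply: (control_measurable Yc fY planP Yy0) => //; exact: my.
by have [M kM] := cost_bounded Yc Uc kc; exists M => w; exact: kM.
Qed.

(* The noise of step [t] is independent of the state at time [t], so it may be
   integrated out first, which turns [g] at time [t.+1] into [expect_next g]. *)
Lemma expectation_step_ge0 (c g : 'rV[R]_n -> R) (a : R) t :
  bounded_borel Y c -> bounded_borel Y g ->
  (forall y u, graph Y Umap (y, u) ->
     (0 <= (a * k y u + c y)%:E + expect_next f law g y u)%E) ->
  0 <= a * \int[P]_w k (y_ t w) (u_ t w) + \int[P]_w c (y_ t w)
       + \int[P]_w g (y_ t.+1 w).
Proof.
move=> cb gb cg0.
have [Mc cM] := cb.2; have [Mg gM] := gb.2.
have [Mk kM] := cost_bounded Yc Uc kc.
pose T := g_sigma_algebraType (past_cylinders s t).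
(* The first coordinate is a sample point seen through the past, the second a noise value; at
   [(w, s t w)] the last term is [g] at time [t.+1]. The coefficient [a] will be [0] for the
   inequality on [psi] and [1] for the one on the cost. *)
pose h (p : T * borel S) : R :=
  a * k (y_ t p.1) (u_ t p.1) + c (y_ t p.1) + g (f (y_ t p.1) (u_ t p.1) p.2).
have myT : measurable_fun [set: T] (y_ t : T -> borel 'rV[R]_n).
  by apply: my => i it; exact: measurable_past.
have muT : measurable_fun [set: T] (u_ t : T -> borel U).
  exact: (control_measurable Yc fY planP Yy0).
have Ynext w x : Y (f (y_ t w) (u_ t w) x).
  by apply: fY => //; exact: (control_in fY planP).
have mh : measurable_fun setT h.
  apply: measurable_funD; first apply: measurable_funD.
  - apply: measurable_funM => //.
    apply: (cost_measurable Yc Uc kc) => //; apply: measurableT_comp => //.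
  - apply: (bounded_borel_state_measurable Yc cb) => //.
    exact: measurableT_comp.
  - apply: (bounded_borel_state_measurable Yc gb) => //.
    apply: (next_state_measurable Yc Uc fc fm) => //; exact: measurableT_comp.
have hM : exists M, forall p, `|h p| <= M.
  exists (`|a| * Mk + Mc + Mg) => p; apply: le_trans (ler_normD _ _) _.
  apply: lerD; last exact: gM.
  apply: le_trans (ler_normD _ _) _; apply: lerD; last exact: cM.
  by rewrite normrM ler_wpM2l//; exact: kM.
(* With the past frozen, the inner integral is the left side of the assumed inequality at the
   current state and control, hence nonnegative for every [w]. *)
have : (0 <= \int[P]_w (h (w, s t w))%:E)%E.
  rewrite (integral_past siid mh hM); apply: integral_ge0 => w _.
  have gin : law.-integrable setT (EFin \o (fun x => g (f (y_ t w) (u_ t w) x))).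
    apply: probability_bounded_integrable; last by exists Mg => x; exact: gM.
    apply: (bounded_borel_state_measurable Yc gb) => //.
    exact: fm.
  pose c0 := a * k (y_ t w) (u_ t w) + c (y_ t w).
  have -> : (\int[law]_x (h (w, x))%:E =
      c0%:E + \int[law]_x (g (f (y_ t w) (u_ t w) x))%:E)%E.
    have <- : (\int[law]_x (cst c0 x)%:E = c0%:E)%E.
      by have := expectation_cst law c0; rewrite unlock.
    by rewrite -integralD_EFin//; exact: finite_measure_integrable_cst.
  have := cg0 (y_ t w) (u_ t w); rewrite /expect_next unlock; apply.
  by split=> //=; exact: (control_in fY planP).
have ik := integrable_cost t; have ic := integrable_state t cb.
have ig := integrable_state t.+1 gb.
have iak : P.-integrable setT (EFin \o (fun w => a * k (y_ t w) (u_ t w))).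
  by apply: eq_integrable (integrableZl measurableT a ik) => // w _.
rewrite -RintegralZl// -!RintegralD//; last first.
  by apply: eq_integrable (integrableD measurableT iak ic) => // w _.
by rewrite /Rintegral => ?; exact: fine_ge0.
Qed.

Lemma normr_Rintegral_state (g : 'rV[R]_n -> R) M t : bounded_borel Y g ->
  (forall y, Y y -> `|g y| <= M) -> `|\int[P]_w g (y_ t w)| <= M.
Proof.
move=> gb gM; have ig := integrable_state t gb.
apply: le_trans (le_normr_Rintegral measurableT ig) _.
rewrite -[leRHS](Rintegral_probability_cst P); apply: le_Rintegral => //.
- exact: integrable_norm.
- exact: finite_measure_integrable_cst.
- by move=> w _; exact: gM.
Qed.

Lemma Rintegral_stateB (g h : 'rV[R]_n -> R) t :
  bounded_borel Y g -> bounded_borel Y h ->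
  \int[P]_w (g (y_ t w) - h (y_ t w)) =
  \int[P]_w g (y_ t w) - \int[P]_w h (y_ t w).
Proof. by move=> gb hb; rewrite RintegralB//; exact: integrable_state. Qed.

Lemma expectation_total_cost T :
  ('E_P[fun w => (\sum_(0 <= t < T) k (y_ t w) (u_ t w))%R] =
   (\sum_(0 <= t < T) \int[P]_w k (y_ t w) (u_ t w))%:E)%E.
Proof.
rewrite unlock -sumEFin.
under eq_integral do rewrite -sumEFin.
rewrite integral_sum//; last by move=> t; exact: integrable_cost.
apply: eq_bigr => t _; rewrite fineK//.
by apply: integrable_fin_num => //; exact: integrable_cost.
Qed.

Lemma average_costE : average_cost f k P s y0 plan =
  limn_esup (fun T => (T%:R^-1 *
    \sum_(0 <= t < T) \int[P]_w k (y_ t w) (u_ t w))%:E).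
Proof.
by rewrite /average_cost; congr limn_esup; apply/funext => T;
  rewrite expectation_total_cost EFinM.
Qed.

(** Finiteness lets the extended-real dual inequality be rearranged as an inequality between
    reals. *)
Lemma expect_next_fin (g : 'rV[R]_n -> R) y u : bounded_borel Y g ->
  graph Y Umap (y, u) -> expect_next f law g y u \is a fin_num.
Proof.
move=> gb [/= Yy' Uu]; have [_ [M gM]] := gb.
rewrite /expect_next unlock; apply: integrable_fin_num => //.
apply: probability_bounded_integrable; last by exists M => x; apply/gM/fY.
apply: (bounded_borel_state_measurable Yc gb) => [|x]; last exact: fY.
exact: fm.
Qed.

(** * Weak duality and complementary slackness *)

Section duality.
Context (psi eta : 'rV[R]_n -> R) (m : R).
Hypotheses (psib : bounded_borel Y psi) (etab : bounded_borel Y eta).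

Lemma expectation_psi_ge :
  (forall y u, graph Y Umap (y, u) ->
    (0 <= expect_next f law psi y u - (psi y)%:E)%E) ->
  forall t, psi y0 <= \int[P]_w psi (y_ t w).
Proof.
move=> psi0; elim=> [|t IH]; first by rewrite -[leLHS](Rintegral_probability_cst P).
apply: le_trans IH _.
(* The one-step inequality is used with cost coefficient [0] and [c = 0 - psi]. *)
have cb := bounded_borelB (bounded_borel_cst Y 0) psib.
have := @expectation_step_ge0 _ _ 0 t cb psib.
rewrite mul0r add0r (Rintegral_stateB t (bounded_borel_cst Y 0) psib).
rewrite Rintegral_probability_cst sub0r addrC subr_ge0; apply => y u yu.
by rewrite mul0r add0r sub0r EFinN addeC; exact: psi0.
Qed.

Lemma weak_duality :
  (forall y u, graph Y Umap (y, u) ->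
    (m%:E <= (k y u + (psi y0 - psi y))%:E + expect_next f law eta y u
             - (eta y)%:E)%E /\
    (0 <= expect_next f law psi y u - (psi y)%:E)%E) ->
  (m%:E <= average_cost f k P s y0 plan)%E.
Proof.
move=> feas.
pose b t := \int[P]_w eta (y_ t w).
have [M etaM] := etab.2.
have bM t : `|b t| <= M by exact: normr_Rintegral_state.
have step t : m + b t - b t.+1 <= \int[P]_w k (y_ t w) (u_ t w).
  pose c y := psi y0 - psi y - eta y - m.
  have b1 := bounded_borelB (bounded_borel_cst Y (psi y0)) psib.
  have b2 := bounded_borelB b1 etab.
  have cb := bounded_borelB b2 (bounded_borel_cst Y m).
  have cost_ge0 y u : graph Y Umap (y, u) ->
      (0 <= (1 * k y u + c y)%:E + expect_next f law eta y u)%E.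
    move=> yu; have [+ _] := feas y u yu; have := expect_next_fin etab yu.
    by case: (expect_next f law eta y u) => //= r _; rewrite !lee_fin /c; lra.
  have := @expectation_step_ge0 _ _ 1 t cb etab cost_ge0.
  rewrite (Rintegral_stateB t b2 (bounded_borel_cst Y m)) (Rintegral_stateB t b1 etab).
  rewrite (Rintegral_stateB t (bounded_borel_cst Y (psi y0)) psib).
  rewrite !Rintegral_probability_cst mul1r -/(b t) -/(b t.+1).
  have := expectation_psi_ge (fun y u yu => (feas y u yu).2) t; lra.
(* After telescoping, the error [b 0 - b T] is at least [- (M + M)]. *)
rewrite average_costE; apply: (@limn_esup_mean_ge _ _ (- (M + M)) _ 0%N) => T _.
apply: le_trans (ler_sum_nat (fun t _ => step t)).
rewrite sumr_add_telescope// subn0 -addrA lerD2l.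
have := bM 0%N; have := bM T; rewrite !ler_norml => /andP[_ ?] /andP[? _].
by rewrite opprD lerD// lerN2.
Qed.

Lemma average_cost_le (T0 : nat) :
  (forall t, (T0 <= t)%N -> \int[P]_w k (y_ t w) (u_ t w) =
     m + \int[P]_w eta (y_ t w) - \int[P]_w eta (y_ t.+1 w)) ->
  (average_cost f k P s y0 plan <= m%:E)%E.
Proof.
move=> step; have [M etaM] := etab.2.
pose a t := \int[P]_w k (y_ t w) (u_ t w).
pose b t := \int[P]_w eta (y_ t w).
have bM t : `|b t| <= M by exact: normr_Rintegral_state.
rewrite average_costE.
(* The constant collects the costs before [T0], the correction [- T0 * m] since only [T - T0] steps
   contribute [m], and the bound [M + M] on [b T0 - b T]. *)
apply: (@limn_esup_mean_le _ _
  (\sum_(0 <= t < T0) a t - T0%:R * m + (M + M)) _ T0) => T T0T.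
have -> : \sum_(0 <= t < T) \int[P]_w k (y_ t w) (u_ t w) =
    \sum_(0 <= t < T0) a t + \sum_(T0 <= t < T) (m + b t - b t.+1).
  rewrite (big_cat_nat (n := T0))//=; congr (_ + _).
  by apply: eq_big_nat => t /andP[T0t _]; exact: step.
rewrite sumr_add_telescope// natrB// mulrBl.
have := bM T0; have := bM T; rewrite !ler_norml => /andP[+ _] /andP[_].
lra.
Qed.

(** Testing the conditional expectation on the whole space gives [E[Z] = E[eta(y(t+1))]].
    Integrating the almost sure equality then yields the claim, the [psi] terms cancelling by the
    last hypothesis. *)
Lemma slack_step (t : nat) (Z : Omega -> R) :
  is_cond_expectation P (fun w => eta (f (y_ t w) (u_ t w) (s t w)))
    (y_ t : Omega -> borel 'rV[R]_n) Z ->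
  {ae P, forall w, k (y_ t w) (u_ t w) + (psi y0 - psi (y_ t w)) + Z w
                   - eta (y_ t w) = m} ->
  \int[P]_w psi (y_ t w) = psi y0 ->
  \int[P]_w k (y_ t w) (u_ t w) =
    m + \int[P]_w eta (y_ t w) - \int[P]_w eta (y_ t.+1 w).
Proof.
move=> [_ iZ /(_ setT measurableT)]; rewrite preimage_setT => EZ aeE Epsi.
have {}EZ : \int[P]_w Z w = \int[P]_w eta (y_ t.+1 w) by rewrite /Rintegral EZ.
have ik := integrable_cost t.
have b1 := bounded_borelB (bounded_borel_cst Y (psi y0)) psib.
have i1 := integrable_state t b1; have ieta := integrable_state t etab.
have ik1 := integrableD measurableT ik i1.
have ik1Z := integrableD measurableT ik1 iZ.
have iall := integrableB measurableT ik1Z ieta.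
have : \int[P]_w (k (y_ t w) (u_ t w) + (psi y0 - psi (y_ t w)) + Z w
                   - eta (y_ t w)) = m.
  rewrite -[RHS](Rintegral_probability_cst P); congr fine; apply: ae_eq_integral => //.
  - exact: (measurable_int _ iall).
  - by apply/measurable_EFinP; exact: measurable_cst.
  - by apply: filterS aeE => w mE _ /=; rewrite mE.
rewrite RintegralB// RintegralD// RintegralD//.
rewrite (Rintegral_stateB t (bounded_borel_cst Y (psi y0)) psib).
by rewrite Rintegral_probability_cst Epsi EZ; lra.
Qed.

End duality.
End trajectory_costs.

(** * Optimality of the plan and equality with the dual value *)

Theorem proposition6p2
  (R : realType) (n : nat)
  (U : pointedMetricType R) (S : ptopologicalType)
  (Y : set 'rV[R]_n)
  (Umap : 'rV[R]_n -> set U)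
  (f : 'rV[R]_n -> U -> S -> 'rV[R]_n)
  (k : 'rV[R]_n -> U -> R)
  (d : measure_display) (Omega : measurableType d) (P : probability Omega R)
  (s : nat -> {RV P >-> borel S})
  (law : probability (borel S) R)
  (HY0 : Y !=set0) (HYc : compact Y)
  (HUc : compact [set: U])
  (HS : polish_space R S)
  (Hfb : exists M : R, forall y u x, Y y -> `|f y u x| <= M)
  (Hfc : forall x : S,
     {within Y `*` [set: U], continuous (fun p : 'rV[R]_n * U => f p.1 p.2 x)})
  (Hfm : forall y u, Y y ->
     measurable_fun [set: borel S] (f y u : borel S -> borel 'rV[R]_n))
  (Hs : iid_with_law s law)
  (HUne : forall y, Y y -> Umap y !=set0)
  (HUcp : forall y, Y y -> compact (Umap y))
  (HUusc : upper_semicontinuous_on Y Umap)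
  (HfY : forall y u x, Y y -> Umap y u -> Y (f y u x))
  (Hk : {within Y `*` [set: U], continuous (fun p : 'rV[R]_n * U => k p.1 p.2)})
  (y0 : 'rV[R]_n) (Hy0 : Y y0)
  (psi eta : 'rV[R]_n -> R)
  (Hdual : dual_optimal Y Umap f k law y0 psi eta)
  (plan : nat -> 'rV[R]_n -> U) (Hplan : control_plan Y Umap plan)
  (T0 : nat) (HT0 : (0 < T0)%N)
  (Hslack : forall t, (T0 <= t)%N ->
     exists2 Z : Omega -> R,
       is_cond_expectation P
         (fun w => eta (f (state f s plan y0 t w) (control f s plan y0 t w)
                          (s t w)))
         (state f s plan y0 t : Omega -> borel 'rV[R]_n) Z &
       {ae P, forall w,
          (k (state f s plan y0 t w) (control f s plan y0 t w)
           + (psi y0 - psi (state f s plan y0 t w))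
           + Z w - eta (state f s plan y0 t w))%:E
          = dual_value Y Umap f k law y0})
  (Hpsi : forall t, (T0 <= t)%N ->
     'E_P[fun w => psi (state f s plan y0 t w)]%E = (psi y0)%:E) :
  average_cost f k P s y0 plan = optimal_value Y Umap f k P s y0 /\
  optimal_value Y Umap f k P s y0 = dual_value Y Umap f k law y0.
Proof.
have [psib etab feas] := Hdual.
(* The dual value is a priori an extended real. It is finite because it equals a real number almost
   surely, hence at some [w], the total mass being positive. *)
have [m mE] : exists m : R, dual_value Y Umap f k law y0 = m%:E.
  have [Z _ aeZ] := Hslack T0 (leqnn T0).
  have P_gt0 : (0 < P setT)%E by rewrite probability_setT lte01.
  have [w <-] := @filter_ex _ _ (ae_properfilter_algebraOfSetsType P_gt0) _ aeZ.
  by eexists.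
rewrite mE in feas Hslack *.
(* The optimal pair itself certifies the bound [m] for every plan, so no approximation of the
   supremum is involved. *)
have ge_m plan' : control_plan Y Umap plan' ->
    (m%:E <= average_cost f k P s y0 plan')%E.
  move=> planP'.
  exact: (weak_duality HYc HUc Hfc Hfm HfY Hk Hs planP' Hy0 psib etab feas).
have le_m : (average_cost f k P s y0 plan <= m%:E)%E.
  apply: (average_cost_le HYc HUc Hfc Hfm HfY Hk Hplan Hy0 etab (T0 := T0)).
  move=> t T0t; have [Z condZ aeZ] := Hslack t T0t.
  have Epsi : \int[P]_w psi (state f s plan y0 t w) = psi y0.
    by have := Hpsi t T0t; rewrite unlock /Rintegral => ->.
  apply: (slack_step HYc HUc Hfc Hfm HfY Hk Hplan Hy0 psib etab condZ _ Epsi).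
  by apply: filterS aeZ => w [].
have avgE : average_cost f k P s y0 plan = m%:E.
  by apply/eqP; rewrite eq_le le_m ge_m.
have optE : optimal_value Y Umap f k P s y0 = m%:E.
  apply/eqP; rewrite eq_le; apply/andP; split.
    by rewrite -avgE; apply: ereal_inf_lbound; exists plan.
  by apply: le_ereal_inf_tmp => _ [plan' planP' <-]; exact: ge_m.
by rewrite avgE optE.
Qed.
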